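(* Let $d\ge 2$, let $\mu_n\in\mathbb{R}^d$, and let $\Sigma_n\in\mathbb{R}^{d\times d}$ be symmetric positive definite with eigendecomposition $\Sigma_n=U_nD_nU_n^T$ ($U_n$ orthogonal, $D_n$ diagonal with positive entries). Let $P_n=N(\mu_n,\Sigma_n)$ be the Gaussian distribution on $\mathbb{R}^d$ with mean $\mu_n$ and covariance $\Sigma_n$. Let $w_n,w_n'\in\mathbb{R}^d$ (a sampled parameter vector and its updated value), with $w_n'\neq\mu_n$. For an invertible matrix $A\in\mathbb{R}^{d\times d}$ and $b\in\mathbb{R}^d$, let $P_{n+1}^{A,b}=N(A\mu_n+b,\,A\Sigma_nA^T)$ denote the push-forward of $P_n$ under the affine map $w\mapsto Aw+b$. Consider the problem $$\min_{A,b}\ D_{\mathrm{KL}}\big[P_{n+1}^{A,b}\,\|\,P_n\big]=\min_{A,b}\int P_{n+1}^{A,b}(w)\log\frac{P_{n+1}^{A,b}(w)}{P_n(w)}\,dw\quad\text{subject to}\quad w_n'=Aw_n+b.$$ Let $\hat\mu,\hat\nu\in\mathbb{R}^d$ be orthonormal vectors and $u,v_\parallel,v_\perp\in\mathbb{R}$ be such that $$u\hat\mu=\tfrac{1}{\sqrt{D_n}}U_n^T(w_n-\mu_n),\qquad v_\parallel\hat\mu+v_\perp\hat\nu=\tfrac{1}{\sqrt{D_n}}U_n^T(w_n'-\mu_n).$$ Then the solution $A^\ast$ of the problem is $$A^\ast=I_{d\times d}+U_n\sqrt{D_n}\left\{\bigl[\hat\mu\ \ \hat\nu\bigr]\left(A_{2\times2}-I_{2\times2}\right)\begin{bmatrix}\hat\mu^T\\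 \hat\nu^T\end{bmatrix}\right\}\frac{1}{\sqrt{D_n}}U_n^T,$$ where, writing $V=v_\parallel^2+v_\perp^2$ and $c=\dfrac{u\sqrt{V}+\delta_1\sqrt{4+u^2(4+V)}}{2(1+u^2)}$, $$A_{2\times2}=\frac{1}{\sqrt{V}}\begin{bmatrix}c\,v_\parallel & -\delta_2 v_\perp\\ c\,v_\perp & \delta_2 v_\parallel\end{bmatrix}$$ for some $\delta_1,\delta_2\in\{-1,+1\}$. The hyperparameters of the corresponding posterior $P_{n+1}=N(\mu_{n+1},\Sigma_{n+1})$ are $$\Sigma_{n+1}=A^\ast\Sigma_nA^{\ast T},\qquad \mu_{n+1}=A^\ast(\mu_n-w_n)+w_n'.$$
   Context: $\sqrt{D_n}$ and $\frac{1}{\sqrt{D_n}}$ denote the diagonal matrices whose entries are the square roots (resp. reciprocal square roots) of the diagonal entries of $D_n$. $[\hat\mu\ \hat\nu]$ is the $d\times 2$ matrix with columns $\hat\mu,\hat\nu$. $D_{\mathrm{KL}}$ is the Kullback–Leibler divergence. *)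

(* Defs.v *)
From HB Require Import structures.
From mathcomp Require Import all_boot all_order all_algebra.
From mathcomp Require Import all_classical all_reals all_analysis.
Set Implicit Arguments. Unset Strict Implicit. Unset Printing Implicit Defensive.
Import Order.TTheory GRing.Theory Num.Theory.
Import numFieldNormedType.Exports.
Local Open Scope ring_scope.

(* Lebesgue integral over R^n (column vectors), written as the iterated
   one-dimensional Lebesgue integral (Fubini order: first coordinate outermost). *)
Fixpoint intRn (R : realType) (n : nat) : ('cV[R]_n -> R) -> R :=
  match n with
  | 0 => fun f => f 0
  | n'.+1 => fun f =>
      (\int[@lebesgue_measure R]_(x in [set: R])
         intRn (fun v : 'cV[R]_n' => f (col_mx (x%:M : 'cV[R]_1) v)))%R
  end.

Definition gauss_pdf (R : realType) (d : nat) (m : 'cV[R]_d) (S : 'M[R]_d)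
    (x : 'cV[R]_d) : R :=
  expR (- (2^-1 * ((x - m)^T *m invmx S *m (x - m)) 0 0))
  / Num.sqrt ((2 * pi) ^+ d * \det S).

Definition KL_gauss (R : realType) (d : nat) (m1 : 'cV[R]_d) (S1 : 'M[R]_d)
    (m2 : 'cV[R]_d) (S2 : 'M[R]_d) : R :=
  intRn (fun w => gauss_pdf m1 S1 w * ln (gauss_pdf m1 S1 w / gauss_pdf m2 S2 w)).

Definition pf_mean (R : realType) (d : nat) (A : 'M[R]_d) (b mu : 'cV[R]_d) :=
  A *m mu + b.
Definition pf_cov (R : realType) (d : nat) (A S : 'M[R]_d) := A *m S *m A^T.

Definition is_solution (R : realType) (d : nat) (mu : 'cV[R]_d) (S : 'M[R]_d)
    (w w' : 'cV[R]_d) (A : 'M[R]_d) (b : 'cV[R]_d) : Prop :=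
  [/\ A \in unitmx, w' = A *m w + b &
      forall (A' : 'M[R]_d) (b' : 'cV[R]_d), A' \in unitmx -> w' = A' *m w + b' ->
        KL_gauss (pf_mean A b mu) (pf_cov A S) mu S
        <= KL_gauss (pf_mean A' b' mu) (pf_cov A' S) mu S].

Definition cols2 (R : ringType) (d : nat) (x y : 'cV[R]_d) : 'M[R]_(d, 2) :=
  \matrix_(i < d, j < 2) if j == 0 :> nat then x i 0 else y i 0.

Definition mx2 (R : ringType) (a b c e : R) : 'M[R]_2 :=
  \matrix_(i < 2, j < 2)
    if i == 0 :> nat then (if j == 0 :> nat then a else b)
    else (if j == 0 :> nat then c else e).

(* Main.v *)
Require Import Defs.
From HB Require Import structures.
From mathcomp Require Import all_boot all_order all_algebra.
From mathcomp Require Import all_classical all_reals all_analysis.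
From mathcomp Require Import measurable_realfun ring lra.
Import Order.TTheory GRing.Theory Num.Theory.
Import numFieldNormedType.Exports.
Set Implicit Arguments. Unset Strict Implicit. Unset Printing Implicit Defensive.
Local Open Scope classical_set_scope.
Local Open Scope ring_scope.

(* Let W be the whitening matrix D^(-1/2) U^T, so that Sigma^-1 = W^T W, and put
   B = W A W^-1, x = W (w - mu) = u muh and y = W (w' - mu).  The closed form of
   the divergence between Gaussians turns the objective into
     1/2 (tr (B^T B) + |y - B x|^2 - ln (det B)^2 - d).
   Let r = |B muh|.  Every positive definite M satisfies d + ln (det M) <= tr M;
   for M = K B^T B K, where K shrinks muh by the factor r, this reads
     tr (B^T B) - ln (det B)^2 >= d - 1 + r^2 - ln r^2,
   while |y - B x| >= | |y| - |u| r | by Cauchy-Schwarz.  The resulting function of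
   r is minimal at the positive root |c| of (1 + u^2) r^2 - |u| |y| r = 1, and both
   bounds are attained when B maps muh to c y / |y|, maps nuh to a unit vector
   orthogonal to y in the plane of muh and nuh, and fixes the complement of that
   plane.  The sign delta1 is the sign of u, and delta2 = 1 is one valid choice. *)

(** * Gaussian moments on the line *)

(** Dominated convergence, with [|f|] as dominating function, reduces the claim to the windows
    [[m - n, m + n]], where the fundamental theorem of calculus gives [F (m + n) - F (m - n)]. *)
Lemma integral_derivative_eq0 (R : realType) (f F : R -> R) (m : R) :
  continuous f -> (forall x, is_derive x (1 : R) F (f x)) ->
  lebesgue_measure.-integrable [set: R] (EFin \o f) ->
  F (m + n%:R) @[n --> \oo] --> (0 : R) ->
  F (m - n%:R) @[n --> \oo] --> (0 : R) ->
  (\int[lebesgue_measure]_x (f x)%:E = 0)%E.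
Proof.
move=> cf dF intf Fy FNy.
pose S (n : nat) := [set` `[m - n%:R, m + n%:R]].
have mS n : measurable (S n) by exact: measurable_itv.
have dcF : (\int[lebesgue_measure]_x ((f \_ (S n)) x)%:E)%E
   @[n --> \oo] --> (\int[lebesgue_measure]_x (f x)%:E)%E.
  apply: (@dominated_cvg _ _ _ lebesgue_measure setT _ _ _
    (fun x => `|f x|%:E)) => //.
  - move=> k; apply/measurable_EFinP/(measurable_restrictT _ (mS k)).
    by apply: measurable_funTS; exact: continuous_measurable_fun.
  - move=> x _; apply: cvg_near_cst.
    near=> k; rewrite /= patchE ifT//; apply/mem_set; rewrite /S /= in_itv/=.
    have : `|x - m| <= k%:R by near: k; exact: nbhs_infty_ger.
    by rewrite ler_norml => /andP[? ?]; lra.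
  - exact: integrable_abse intf.
  - move=> k x _; rewrite /patch; case: ifP => _ /=.
      by rewrite lee_fin.
    by rewrite normr0 lee_fin.
(* The shift to [n.+1] keeps the interval nondegenerate, as the fundamental theorem requires. *)
have FTC n : (\int[lebesgue_measure]_x ((f \_ (S n.+1)) x)%:E =
    (F (m + n.+1%:R) - F (m - n.+1%:R))%:E)%E.
  transitivity (\int[lebesgue_measure]_(x in S n.+1) (f x)%:E)%E.
    by rewrite [RHS]integral_mkcond; apply: eq_integral => x _;
      rewrite /patch; case: ifP.
  rewrite (@continuous_FTC2 _ _ F) ?EFinB//.
  - have : (0 : R) < n.+1%:R by []. lra.
  - exact/continuous_subspaceT.
  - have cF x : {for x, continuous F}.
      by apply/differentiable_continuous/derivable1_diffP; case: (dF x).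
    split => [x _||].
    + by case: (dF x).
    + by apply: cvg_at_right_filter; exact: cF.
    + by apply: cvg_at_left_filter; exact: cF.
  - by move=> x _; rewrite derive1E; case: (dF x).
have dcF0 : (\int[lebesgue_measure]_x ((f \_ (S n)) x)%:E)%E @[n --> \oo] --> (0 : \bar R)%E.
  rewrite -cvg_shiftS.
  under eq_fun do rewrite /= FTC.
  apply: cvg_EFin; first exact: nearW.
  rewrite -[0](subr0 0); apply: cvgB.
    by rewrite (cvg_shiftS (fun n => F (m + n%:R))).
  by rewrite (cvg_shiftS (fun n => F (m - n%:R))).
by rewrite -(cvg_lim (@ereal_hausdorff R) dcF) (cvg_lim (@ereal_hausdorff R) dcF0).
Unshelve. all: by end_near. Qed.

(** With [s = 1 / sqrt (2 a)] the integrand is [normal_pdf m s] divided by its peak, so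
    integrability and total mass come from the normal law. *)
Lemma integral_gauss_scaled (R : realType) (a m : R) : 0 < a ->
  lebesgue_measure.-integrable [set: R]
    (EFin \o (fun x => expR (- (a * (x - m) ^+ 2)))) /\
  \int[lebesgue_measure]_x expR (- (a * (x - m) ^+ 2)) = Num.sqrt (pi / a).
Proof.
move=> a0.
pose s := (Num.sqrt (2 * a))^-1.
have s2 : s ^+ 2 *+ 2 = a^-1.
  rewrite /s exprVn sqr_sqrtr ?mulr_ge0 ?ltW// -mulr_natl.
  by field; rewrite gt_eqF.
have s0 : s != 0 by rewrite gt_eqF// invr_gt0 sqrtr_gt0 mulr_gt0.
have E x : expR (- (a * (x - m) ^+ 2)) =
    (normal_peak s)^-1 * normal_pdf m s x.
  rewrite normal_pdfE// mulKf ?gt_eqF ?normal_peak_gt0//.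
  by rewrite /normal_fun s2 invrK mulNr mulrC.
have P : (normal_peak s)^-1 = Num.sqrt (pi / a).
  by rewrite /normal_peak invrK -mulrnAl s2 mulrC.
have I := integrable_normal_pdf m s.
split.
  have -> : EFin \o (fun x => expR (- (a * (x - m) ^+ 2))) =
    (fun x : R => ((normal_peak s)^-1)%:E * (normal_pdf m s x)%:E)%E.
    by apply/funext => x /=; rewrite E EFinM.
  exact: integrableZl.
under eq_Rintegral do rewrite E.
by rewrite RintegralZl// P /Rintegral integral_normal_pdf mulr1.
Qed.

Lemma continuous_gauss_quad (R : realType) (a m al be ga : R) :
  continuous (fun x : R =>
    expR (- (a * (x - m) ^+ 2)) * (al * (x - m) ^+ 2 + be * (x - m) + ga)).
Proof.
move=> x; apply: cvgM.
  apply: continuous_comp; last exact: continuous_expR.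
  apply: cvgN; apply: cvgMr; rewrite expr2; apply: cvgM; apply: cvgB.
  all: try exact: cvg_id.
  all: try exact: cvg_cst.
apply: cvgD; last exact: cvg_cst.
apply: cvgD; apply: cvgMr; [rewrite expr2; apply: cvgM|]; apply: cvgB.
all: try exact: cvg_id.
all: try exact: cvg_cst.
Qed.

(** Since [exp z >= 1 + z], the exponential is at most [1 / (1 + a t^2)], which beats the affine
    factor and leaves a bound [K / t]. *)
Lemma cvg_gauss_affine (R : realType) (a b c : R) : 0 < a ->
  expR (- (a * n%:R ^+ 2)) * (b * n%:R + c) @[n --> \oo] --> (0 : R).
Proof.
move=> a0; rewrite -cvg_shiftS; apply/norm_cvg0P.
pose K := (`|b| + `|c|) / a.
have K0 : 0 <= K by rewrite divr_ge0 ?addr_ge0// ltW.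
have HK : K * harmonic n @[n --> \oo] --> (0 : R).
  by rewrite -(mulr0 K); apply: cvgMr; exact: cvg_harmonic.
apply: (@squeeze_cvgr _ _ _ _ (cst 0) (fun n => K * harmonic n)) => //.
- apply: nearW => n /=; rewrite normr_ge0/= normrM ger0_norm ?expR_ge0//.
  set t : R := n.+1%:R.
  have t1 : 1 <= t by rewrite /t ler1n.
  set e := expR _.
  have e0 : 0 < e by exact: expR_gt0.
  have he : e * (1 + a * t ^+ 2) <= 1.
    rewrite -[leRHS](expRxMexpNx_1 (a * t ^+ 2)) mulrC ler_pM2r//.
    exact: expR_ge1Dx.
  have h1 : `|b * t + c| <= (`|b| + `|c|) * t.
    rewrite (le_trans (ler_normD _ _))// normrM (ger0_norm (le_trans ler01 t1)).
    by rewrite mulrDl lerD// ler_peMr.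
  rewrite (le_trans (ler_wpM2l (ltW e0) h1))//.
  rewrite mulrCA /K -mulrA ler_wpM2l ?addr_ge0//.
  have h2 : e * t * (a * t) <= 1 by nra.
  rewrite /= -invfM -[leRHS]mul1r ler_pdivlMr ?mulr_gt0//; lra.
- exact: cvg_cst.
Qed.

(** Half of the exponent is spent on the polynomial: with [y = x - m] and [e = exp (- a y^2 / 2)],
    one factor [e] bounds the polynomial by a constant and the other is integrable. *)
Lemma integrable_gauss_quad (R : realType) (a m al be ga : R) : 0 < a ->
  lebesgue_measure.-integrable [set: R] (EFin \o (fun x =>
    expR (- (a * (x - m) ^+ 2)) * (al * (x - m) ^+ 2 + be * (x - m) + ga))).
Proof.
move=> a0.
have a20 : 0 < a / 2 by rewrite divr_gt0.
have [I _] := integral_gauss_scaled m a20.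
(* This constant collects [|y| <= y^2 + 1], [y^2 e <= 2 / a] and [e <= 1]. *)
pose K := (`|al| + `|be|) * (2 / a) + (`|be| + `|ga|).
have IK := integrableZl measurableT K I.
apply: le_integrable IK => //.
  apply/measurable_EFinP; apply: continuous_measurable_fun.
  exact: continuous_gauss_quad.
move=> x _ /=; rewrite lee_fin normrM [leRHS]normrM !(ger0_norm (expR_ge0 _)).
set y := x - m; set E := expR _; set e := expR _.
have Ee : E = e ^+ 2 by rewrite expr2 -expRD; congr expR; field.
have e0 : 0 < e by exact: expR_gt0.
have he : e * (1 + a / 2 * y ^+ 2) <= 1.
  rewrite -[leRHS](expRxMexpNx_1 (a / 2 * y ^+ 2)) mulrC ler_pM2r//.
  exact: expR_ge1Dx.
have y20 := sqr_ge0 y.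
have ye : y ^+ 2 * e <= 2 / a.
  by rewrite ler_pdivlMr//; nra.
have e1 : e <= 1.
  have : 0 <= e * (a / 2 * y ^+ 2).
    by apply: mulr_ge0; [exact: ltW|apply: mulr_ge0 => //; exact: ltW].
  by move: he; rewrite mulrDr mulr1; lra.
have hq : `|al * y ^+ 2 + be * y + ga| <=
    (`|al| + `|be|) * y ^+ 2 + (`|be| + `|ga|).
  apply: (le_trans (ler_normD _ _)); rewrite (le_trans (lerD (ler_normD _ _) (lexx _)))//.
  rewrite (normrM al) (normrM be) (ger0_norm y20).
  have : `|y| <= y ^+ 2 + 1.
    by rewrite -(real_normK (num_real y)); have := normr_ge0 y; nra.
  by have := normr_ge0 be; nra.
have [? ? ?] : [/\ 0 <= `|al|, 0 <= `|be| & 0 <= `|ga| ] by [].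
have a20' : 0 < 2 / a by rewrite divr_gt0.
rewrite [leRHS]mulrC Ee expr2 -mulrA ler_pM2l//.
rewrite (le_trans (ler_wpM2l (ltW e0) hq))// ger0_norm; last first.
  by rewrite /K addr_ge0 ?addr_ge0// mulr_ge0 ?addr_ge0// ltW.
rewrite mulrDr /K lerD//.
  by rewrite mulrCA ler_wpM2l ?addr_ge0// mulrC.
by rewrite ler_piMl ?addr_ge0.
Qed.

Lemma Rintegral_gauss_quad (R : realType) (a m al be ga : R) : 0 < a ->
  \int[lebesgue_measure]_x
    (expR (- (a * (x - m) ^+ 2)) * (al * (x - m) ^+ 2 + be * (x - m) + ga)) =
  Num.sqrt (pi / a) * (al / (2 * a) + ga).
Proof.
move=> a0.
(* With [y = x - m] and [g = exp(- a y^2)], the integrand is [(c1 + ga) g - F'],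
   where [F = g (c1 y + c0)] vanishes at infinity. *)
pose c1 := al / (2 * a); pose c0 := be / (2 * a).
pose g (x : R) := expR (- (a * (x - m) ^+ 2)).
pose F (x : R) := g x * (c1 * (x - m) + c0).
pose f (x : R) := g x * (- al * (x - m) ^+ 2 + (- be) * (x - m) + c1).
have [Ig Eg] := integral_gauss_scaled m a0.
have If := integrable_gauss_quad m (- al) (- be) c1 a0.
have f0 : (\int[lebesgue_measure]_x (f x)%:E = 0)%E.
  apply: (@integral_derivative_eq0 _ f F m) => //.
  - exact: continuous_gauss_quad.
  - move=> x; rewrite /F /g /f.
    apply: is_derive_eq.
    rewrite /GRing.scale/= /g /c1 /c0; set E := expR _.
    by field; rewrite gt_eqF.
  - have E n : F (m + n%:R) = expR (- (a * n%:R ^+ 2)) * (c1 * n%:R + c0).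
      by rewrite /F /g addrAC subrr add0r.
    by under eq_cvg do rewrite E; exact: cvg_gauss_affine.
  - have E n : F (m - n%:R) = expR (- (a * n%:R ^+ 2)) * (- c1 * n%:R + c0).
      by rewrite /F /g addrAC subrr add0r sqrrN mulrN mulNr.
    by under eq_cvg do rewrite E; exact: cvg_gauss_affine.
transitivity (\int[lebesgue_measure]_x ((c1 + ga) * g x - f x)).
  by apply: eq_Rintegral => x _; rewrite /f /g; ring.
rewrite RintegralB//; last first.
  by apply: (integrableZl _ (c1 + ga) Ig).
rewrite RintegralZl// Eg /Rintegral f0 subr0; exact: mulrC.
Qed.

(** * Positive definite matrices *)

Definition qform (R : comNzRingType) (n : nat) (P : 'M[R]_n) (x : 'cV[R]_n) : R :=
  (x^T *m P *m x) 0 0.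

Definition posdefmx (R : realType) (n : nat) (P : 'M[R]_n) : Prop :=
  P^T = P /\ forall x : 'cV[R]_n, x != 0 -> 0 < qform P x.

Lemma qform_congr (R : comNzRingType) n (T P : 'M[R]_n) x :
  qform (T^T *m P *m T) x = qform P (T *m x).
Proof. by rewrite /qform trmx_mul !mulmxA. Qed.

Lemma qform_block (R : comNzRingType) n (y a : R) b c (d : 'M[R]_n) z :
  qform (block_mx a%:M b c d : 'M[R]_(1 + n)) (col_mx y%:M z) =
  a * y ^+ 2 + ((y *: (b + c^T)) *m z) 0 0 + qform d z.
Proof.
rewrite /qform tr_col_mx mul_row_block mul_row_col !mulmxDl tr_scalar_mx.
have -> : z^T *m c *m y%:M = (y *: (c^T *m z))^T.
  by rewrite mul_mx_scalar linearZ/= trmx_mul trmxK.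
rewrite -!scalar_mxM !mul_scalar_mx -!scalemxAl mulmxDl.
move: (c^T *m z) (b *m z) (z^T *m d *m z) => C B D.
by rewrite !mxE eqxx mulr1n; ring.
Qed.

Lemma posdefmx_unit (R : realType) n (P : 'M[R]_n) : posdefmx P -> P \in unitmx.
Proof.
move=> [_ Ppos]; rewrite unitmxE unitfE; apply/negP => /det0P[v v0 vP].
have := Ppos v^T; rewrite /qform trmxK vP mul0mx mxE ltxx.
by rewrite trmx_eq0 => /(_ v0).
Qed.

Lemma posdefmx_congr (R : realType) n (T P : 'M[R]_n) :
  posdefmx P -> T \in unitmx -> posdefmx (T^T *m P *m T).
Proof.
move=> [Psym Ppos] Tu; split; first by rewrite !trmx_mul Psym trmxK mulmxA.
move=> x x0; rewrite qform_congr; apply: Ppos.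
by apply: contraNneq x0 => Tx0; rewrite -(mulKmx Tu x) Tx0 mulmx0.
Qed.

Lemma posdefmx_inv (R : realType) n (P : 'M[R]_n) :
  posdefmx P -> posdefmx (invmx P).
Proof.
move=> Ppos; have Pu := posdefmx_unit Ppos; have [Psym _] := Ppos.
have -> : invmx P = (invmx P)^T *m P *m invmx P.
  by rewrite trmx_inv Psym mulVmx// mul1mx.
by apply: posdefmx_congr; rewrite ?unitmx_inv.
Qed.

(** Block elimination, with [s] the Schur complement of the trailing block. Eliminating that block
    rather than the first entry gives a unipotent factor that fixes the first coordinate, the one
    [intRn] integrates last. *)
Lemma posdefmx_schur (R : realType) n (P : 'M[R]_(1 + n)) : posdefmx P ->
  exists (s : R) (h : 'cV[R]_n),
  [/\ 0 < s, s <= ulsubmx P 0 0, posdefmx (drsubmx P) &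
    P = (block_mx 1%:M 0 h 1%:M)^T *m block_mx s%:M 0 0 (drsubmx P)
        *m block_mx 1%:M 0 h 1%:M].
Proof.
move=> Ppos; have [Psym Pp] := Ppos.
set P' := drsubmx P.
have P'pos : posdefmx P'.
  split; first by rewrite /P' trmx_drsub Psym.
  move=> v v0.
  have := Pp (col_mx 0 v); rewrite -[P in qform P _]submxK /qform.
  rewrite tr_col_mx trmx0 mul_row_block mul_row_col !mul0mx !mulmx0 !add0r.
  by apply; rewrite col_mx_eq0 negb_and v0 orbT.
have P'u := posdefmx_unit P'pos.
have [P'sym _] := P'pos.
pose h := invmx P' *m dlsubmx P.
pose s := (ulsubmx P - ursubmx P *m h) 0 0.
have bT : (dlsubmx P)^T = ursubmx P by rewrite trmx_dlsub Psym.
have hP : h^T *m P' = ursubmx P.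
  by rewrite /h trmx_mul trmx_inv P'sym mulmxKV.
have E : P = (block_mx 1%:M 0 h 1%:M)^T *m block_mx s%:M 0 0 P'
        *m block_mx 1%:M 0 h 1%:M.
  rewrite -{1}[P]submxK tr_block_mx !mulmx_block !trmx1 !trmx0.
  rewrite !(mulmx0, mul0mx, mulmx1, mul1mx, addr0, add0r).
  by rewrite hP /h mulKVmx// /s -mx11_scalar -/h subrK.
exists s, h; split => //.
(* The unipotent factor sends this vector to the first basis vector, so the form takes the value [s]
   there. *)
- pose x : 'cV[R]_(1 + n) := col_mx 1%:M (- h).
  have x0 : x != 0.
    rewrite /x col_mx_eq0 negb_and; apply/orP; left.
    by apply/eqP => /matrixP/(_ 0 0)/eqP; rewrite !mxE oner_eq0.
  have := Pp x x0; rewrite {1}E qform_congr /x mul_block_col.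
  rewrite !(mulmx1, mul1mx, mul0mx, addr0, subrr) qform_block /qform.
  by rewrite expr1n mulr1 trmx0 addr0 scaler0 mul0mx mulmx0 !mxE !addr0.
- rewrite /s mxE [X in _ + X]mxE gerDl oppr_le0 -hP -/(qform P' h).
  have [->|h0] := eqVneq h 0; first by rewrite /qform mulmx0 mxE.
  by have [_ /(_ h h0)/ltW] := P'pos.
Qed.

Lemma det_schur (R : comNzRingType) n (s : R) (h : 'cV[R]_n) (P : 'M[R]_n) :
  \det ((block_mx 1%:M 0 h 1%:M : 'M[R]_(1 + n))^T *m block_mx s%:M 0 0 P
     *m block_mx 1%:M 0 h 1%:M) = s * \det P.
Proof.
rewrite !det_mulmx det_tr !det_lblock !det1 det_scalar expr1; ring.
Qed.

(** This is [ln z <= z - 1] summed over eigenvalues, but obtained without diagonalising: the Schur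
    complements [s] multiply to the determinant, and each is at most the matching diagonal entry. *)
Lemma posdefmx_logdet_le (R : realType) n (P : 'M[R]_n) : posdefmx P ->
  0 < \det P /\ n%:R + ln (\det P) <= \tr P.
Proof.
elim: n P => [|n IH] P Ppos.
  by rewrite det_mx00 /mxtrace big_ord0 ln1 addr0.
rewrite -[n.+1]/(1 + n)%N in P Ppos *.
have [s [h [s0 sP P'pos E]]] := posdefmx_schur Ppos.
have [d0 dtr] := IH _ P'pos.
rewrite {1 2}E det_schur mulr_gt0// lnM// natrD; split=> //.
rewrite -[P in leRHS]submxK mxtrace_block [ulsubmx P]mx11_scalar mxtrace_scalar.
have : ln s <= s - 1.
  by rewrite -{1}[s](subrKC 1) le_ln1Dx// ltrBrDl subrr.
move: dtr sP; rewrite mulr1n; lra.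
Qed.

(** * Gaussian moments in several dimensions *)

(** By cyclicity of the trace the factors [T] cancel, and a block diagonal inverse sees only the
    diagonal blocks of [Q]. *)
Lemma mxtrace_schur (R : comUnitRingType) n (s : R) (h : 'cV[R]_n)
    (P : 'M[R]_n) (Q : 'M[R]_(1 + n)) :
  s \is a GRing.unit -> P \in unitmx ->
  let T : 'M[R]_(1 + n) := block_mx 1%:M 0 h 1%:M in
  \tr (T^T *m Q *m T *m invmx (T^T *m block_mx s%:M 0 0 P *m T)) =
  ulsubmx Q 0 0 / s + \tr (drsubmx Q *m invmx P).
Proof.
move=> su Pu T.
have Tu : T \in unitmx by rewrite unitmxE det_lblock !det1 mulr1 unitr1.
have Tu' : T^T \in unitmx by rewrite unitmx_tr.
have Bu : (block_mx s%:M 0 0 P : 'M[R]_(1 + n)) *m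
    block_mx (s^-1)%:M 0 0 (invmx P) = 1%:M.
  rewrite mulmx_block !(mulmx0, mul0mx, addr0, add0r) mulmxV// -scalar_mxM.
  by rewrite mulrV// -scalar_mx_block.
have -> : invmx (T^T *m block_mx s%:M 0 0 P *m T) =
    invmx T *m block_mx (s^-1)%:M 0 0 (invmx P) *m invmx T^T.
  have [Bu1 _] := mulmx1_unit Bu.
  have PTu : T^T *m block_mx s%:M 0 0 P *m T \in unitmx by rewrite !unitmx_mul Tu' Bu1.
  apply: (can_inj (mulKmx PTu)); rewrite mulmxV//.
  by rewrite -!mulmxA (mulKVmx Tu) (mulmxA _ _ (invmx _)) Bu mul1mx mulmxV.
rewrite -!mulmxA mulKVmx// mxtrace_mulC -!mulmxA mulVmx// mulmx1.
rewrite -[Q in LHS]submxK mulmx_block !(mulmx0, mul0mx, addr0, add0r).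
by rewrite mxtrace_block [ulsubmx Q]mx11_scalar -scalar_mxM mxtrace_scalar mulr1n !mxE mulr1n.
Qed.

Lemma qformZ (R : comNzRingType) n (a : R) (P : 'M[R]_n) x :
  qform (a *: P) x = a * qform P x.
Proof. by rewrite /qform -scalemxAr -scalemxAl mxE. Qed.

Lemma eq_intRn (R : realType) n (f g : 'cV[R]_n -> R) :
  f =1 g -> intRn f = intRn g.
Proof. by move=> fg; congr intRn; apply/funext. Qed.

(** Induction on the dimension, one coordinate being left for [Rintegral_gauss_quad]. The linear
    form [l] integrates to zero, but recentring the inner integral creates such a term, so the
    induction hypothesis must allow it. *)
Lemma intRn_gauss_quad (R : realType) n (P Q : 'M[R]_n) (l : 'rV[R]_n)
    (m : 'cV[R]_n) (k : R) : posdefmx P ->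
  intRn (fun x => expR (- (2^-1 * qform P (x - m))) *
    (qform Q (x - m) + (l *m (x - m)) 0 0 + k)) =
  Num.sqrt ((2 * pi) ^+ n / \det P) * (\tr (Q *m invmx P) + k).
Proof.
elim: n P Q l m k => [|n IH] P Q l m k Ppos.
  rewrite /= det_mx00 /mxtrace big_ord0 expr0 divr1 sqrtr1 mul1r /qform.
  by rewrite sub0r (flatmx0 m) oppr0 !mulmx0 !mxE mulr0 oppr0 expR0 mul1r !add0r.
rewrite -[n.+1]/(1 + n)%N in P Q l m Ppos *.
have [s [h [s0 _ P'pos E]]] := posdefmx_schur Ppos.
set P' := drsubmx P in P'pos E.
set T := block_mx 1%:M 0 h 1%:M in E.
have Tu : T \in unitmx by rewrite unitmxE det_lblock !det1 mulr1 unitr1.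
have [Q1 EQ] : exists Q1, Q = T^T *m Q1 *m T.
  exists ((invmx T)^T *m Q *m invmx T).
  by rewrite !mulmxA -trmx_mul mulVmx// trmx1 mul1mx mulmxKV.
pose l1 := l *m invmx T.
have El : l = l1 *m T by rewrite /l1 mulmxKV.
pose m1 := usubmx m 0 0; pose m2 := dsubmx m.
have Em : m = col_mx m1%:M m2 by rewrite /m1 -mx11_scalar vsubmxK.
have [dP' _] := posdefmx_logdet_le P'pos.
pose q0 := ulsubmx Q1 0 0.
pose q1 := ursubmx Q1 + (dlsubmx Q1)^T.
pose l10 := lsubmx l1 0 0.
pose C := Num.sqrt ((2 * pi) ^+ n / \det P').
pose t := \tr (drsubmx Q1 *m invmx P').
(* For a fixed first coordinate, the unipotent factor [T] of the Schur
   decomposition recentres the inner integral at [mx], so that it is again of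
   the form covered by the induction hypothesis. *)
have step x : intRn (fun v : 'cV[R]_n =>
     expR (- (2^-1 * qform P (col_mx x%:M v - m))) *
     (qform Q (col_mx x%:M v - m) + (l *m (col_mx x%:M v - m)) 0 0 + k)) =
   expR (- (s / 2 * (x - m1) ^+ 2)) *
   (C * q0 * (x - m1) ^+ 2 + C * l10 * (x - m1) + C * (t + k)).
  set y := x - m1; set e := expR _.
  pose mx := m2 - y *: h.
  transitivity (intRn (fun v : 'cV[R]_n =>
    expR (- (2^-1 * qform P' (v - mx))) *
    (qform (e *: drsubmx Q1) (v - mx) +
     (e *: (y *: q1 + rsubmx l1) *m (v - mx)) 0 0 +
     e * (q0 * y ^+ 2 + l10 * y + k)))).
    apply: eq_intRn => v.
    have Tx : T *m (col_mx x%:M v - m) = col_mx y%:M (v - mx).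
      rewrite Em opp_col_mx add_col_mx -raddfN -raddfD/= -/y /T mul_block_col.
      rewrite !mul1mx mul0mx addr0 mul_mx_scalar /mx; congr col_mx.
      by rewrite opprB [RHS]addrCA.
    have Qx z : qform Q1 (col_mx y%:M z) =
        q0 * y ^+ 2 + ((y *: q1) *m z) 0 0 + qform (drsubmx Q1) z.
      by rewrite -[in LHS](submxK Q1) [ulsubmx Q1]mx11_scalar qform_block.
    have lx z : (l1 *m col_mx y%:M z) 0 0 = l10 * y + (rsubmx l1 *m z) 0 0.
      rewrite -[in LHS](hsubmxK l1) mul_row_col [lsubmx l1]mx11_scalar.
      by rewrite -scalar_mxM [LHS]mxE mxE mulr1n.
    rewrite E EQ El !qform_congr -mulmxA Tx Qx lx qform_block.
    rewrite trmx0 addr0 scaler0 mul0mx qformZ -[e *: _ *m _]scalemxAl mulmxDl.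
    have -> : expR (- (2^-1 * (s * y ^+ 2 + (0 : 'M[R]_1) 0 0
        + qform P' (v - mx)))) = e * expR (- (2^-1 * qform P' (v - mx))).
      by rewrite -expRD mxE; congr expR; field.
    have mxD (A B : 'M[R]_1) : (A + B) 0 0 = A 0 0 + B 0 0 by rewrite mxE.
    have mxZ (a : R) (A : 'M[R]_1) : (a *: A) 0 0 = a * A 0 0 by rewrite mxE.
    by rewrite mxZ mxD; ring.
  rewrite IH// -/C -scalemxAl mxtraceZ -/t; ring.
rewrite [LHS]/=; under eq_Rintegral do rewrite step.
rewrite Rintegral_gauss_quad ?divr_gt0//.
rewrite E EQ mxtrace_schur ?posdefmx_unit// ?unitfE ?gt_eqF//.
rewrite det_schur -/q0 -/t.
(* The factor [pi / (s / 2)] is the one-dimensional normalisation at [a = s / 2]. *)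
have -> : (2 * pi) ^+ (1 + n) / (s * \det P') = pi / (s / 2) * ((2 * pi) ^+ n / \det P') :> R.
  by rewrite exprS; field; rewrite ?gt_eqF.
rewrite [in RHS]sqrtrM ?divr_ge0 ?pi_ge0 ?ltW// -/C ?divr_gt0//.
by field; rewrite gt_eqF.
Qed.

(** * The Kullback-Leibler divergence of Gaussians *)

Lemma qform_shift (R : comNzRingType) n (P : 'M[R]_n) x v : P^T = P ->
  qform P (x + v) = qform P x + (2 *: (v^T *m P) *m x) 0 0 + qform P v.
Proof.
move=> Psym; rewrite /qform (linearD trmx) !mulmxDl !mulmxDr -scalemxAl.
have -> : x^T *m P *m v = (v^T *m P *m x)^T.
  by rewrite !trmx_mul Psym trmxK mulmxA.
move: (x^T *m P *m x) (v^T *m P *m x) (v^T *m P *m v) => X Y Z.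
by rewrite !mxE; ring.
Qed.

Lemma ln_sqrt (R : realType) (x : R) : 0 < x -> ln (Num.sqrt x) = 2^-1 * ln x.
Proof.
move=> x0; rewrite -[in RHS](sqr_sqrtr (ltW x0)) lnXn ?sqrtr_gt0//.
by field.
Qed.

(** The logarithm of the density ratio is a polynomial of degree at most two in [x - m1]; [Q], [l]
    and [k] are its coefficients divided by the normalising constant of the first density. *)
Lemma KL_gaussE (R : realType) n (m1 m2 : 'cV[R]_n) (S1 S2 : 'M[R]_n) :
  posdefmx S1 -> posdefmx S2 ->
  KL_gauss m1 S1 m2 S2 = 2^-1 * (\tr (invmx S2 *m S1) - n%:R
    + qform (invmx S2) (m1 - m2) + ln (\det S2 / \det S1)).
Proof.
move=> pS1 pS2.
have [d1 _] := posdefmx_logdet_le pS1.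
have [d2 _] := posdefmx_logdet_le pS2.
have uS1 := posdefmx_unit pS1.
have pP1 := posdefmx_inv pS1; have [symP2 _] := posdefmx_inv pS2.
set P2 := invmx S2 in symP2 *; set P1 := invmx S1 in pP1.
have pi2 : 0 < (2 * pi) ^+ n :> R by rewrite exprn_gt0// mulr_gt0 ?pi_gt0.
pose Z (S : 'M[R]_n) := Num.sqrt ((2 * pi) ^+ n * \det S).
have Z1 : 0 < Z S1 by rewrite sqrtr_gt0 mulr_gt0.
have Z2 : 0 < Z S2 by rewrite sqrtr_gt0 mulr_gt0.
have lnZ : ln (Z S2 / Z S1) = 2^-1 * ln (\det S2 / \det S1).
  rewrite -ln_sqrt ?divr_gt0// /Z !sqrtrM ?ltW// sqrtrV ?ltW//.
  by congr ln; field; rewrite !gt_eqF ?sqrtr_gt0.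
pose Q := (2 * Z S1)^-1 *: (P2 - P1).
pose l := (Z S1)^-1 *: ((m1 - m2)^T *m P2).
pose k := (Z S1)^-1 * (2^-1 * qform P2 (m1 - m2) + ln (Z S2 / Z S1)).
transitivity (intRn (fun x => expR (- (2^-1 * qform P1 (x - m1))) *
    (qform Q (x - m1) + (l *m (x - m1)) 0 0 + k))).
  apply: eq_intRn => x; rewrite /gauss_pdf -!/(qform _ _) -/P1 -/P2 -!/(Z _).
  set e1 := expR _; set e2 := expR _.
  have -> : e1 / Z S1 / (e2 / Z S2) = e1 / e2 * (Z S2 / Z S1).
    by field; rewrite !gt_eqF ?expR_gt0.
  rewrite lnM ?divr_gt0 ?posrE ?divr_gt0 ?expR_gt0// ln_div ?posrE ?expR_gt0//.
  rewrite !expRK.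
  have -> : x - m2 = (x - m1) + (m1 - m2) by rewrite addrA subrK.
  rewrite (qform_shift _ _ symP2) /l /k /Q.
  move: (x - m1) => z.
  have -> : qform ((2 * Z S1)^-1 *: (P2 - P1)) z =
      (2 * Z S1)^-1 * (qform P2 z - qform P1 z).
    by rewrite qformZ /qform mulmxBr mulmxBl !mxE.
  rewrite -!scalemxAl.
  have mxZ (a : R) (A : 'M[R]_1) : (a *: A) 0 0 = a * A 0 0 by rewrite mxE.
  rewrite !mxZ; field; rewrite ?gt_eqF//.
rewrite intRn_gauss_quad// det_inv invrK -/(Z S1) /P1 invmxK.
rewrite /Q -scalemxAl mxtraceZ mulmxBl mulVmx// raddfB/= mxtrace1 /k lnZ.
by field; rewrite gt_eqF.
Qed.

Definition sqn (R : comNzRingType) n (v : 'cV[R]_n) : R := (v^T *m v) 0 0.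

(* Up to an affine change, the divergence in whitened coordinates: [B] is the
   conjugated linear part, [x] and [y] the whitened sample and its update. *)
Definition objective (R : realType) n (B : 'M[R]_n) (x y : 'cV[R]_n) : R :=
  \tr (B^T *m B) + sqn (y - B *m x) - ln (\det B ^+ 2).

(** The constraint eliminates [b]: the shift of the mean is [(w' - mu) - A (w - mu)]. Conjugation by
    [W] preserves the determinant and turns the trace into a squared Frobenius norm. *)
Lemma KL_pushforward (R : realType) n (mu w w' b : 'cV[R]_n) (S A W : 'M[R]_n) :
  posdefmx S -> W \in unitmx -> invmx S = W^T *m W -> A \in unitmx ->
  w' = A *m w + b ->
  KL_gauss (pf_mean A b mu) (pf_cov A S) mu S =
  2^-1 * (objective (W *m A *m invmx W) (W *m (w - mu)) (W *m (w' - mu)) - n%:R).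
Proof.
move=> pS Wu SW Au Ew'; have uS := posdefmx_unit pS.
have pS1 : posdefmx (pf_cov A S).
  by rewrite /pf_cov -{1}[A]trmxK; apply: posdefmx_congr; rewrite ?unitmx_tr.
have SE : S = invmx W *m (invmx W)^T.
  apply: (can_inj (mulKmx (_ : W^T *m W \in unitmx))).
    by rewrite -SW unitmx_inv.
  by rewrite -{1}SW mulVmx// trmx_inv mulmxA mulmxK// mulmxV// unitmx_tr.
have [dS _] := posdefmx_logdet_le pS.
rewrite KL_gaussE// /objective; congr (_ * _).
have -> : \tr (invmx S *m pf_cov A S) =
    \tr ((W *m A *m invmx W)^T *m (W *m A *m invmx W)).
  rewrite [RHS]mxtrace_mulC !trmx_mul SW /pf_cov {1}SE -!mulmxA.
  by rewrite mxtrace_mulC -!mulmxA [LHS]mxtrace_mulC -!mulmxA [LHS]mxtrace_mulC -!mulmxA.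
have -> : qform (invmx S) (pf_mean A b mu - mu) =
    sqn (W *m (w' - mu) - W *m A *m invmx W *m (W *m (w - mu))).
  rewrite [_ *m (W *m (w - mu))]mulmxA mulmxKV// SW -[W^T]mulmx1 qform_congr /qform mulmx1.
  rewrite /sqn -!mulmxA Ew' /pf_mean -mulmxBr (mulmxBr A).
  by have -> : A *m w + b - mu - (A *m w - A *m mu) = A *m mu + b - mu
    by rewrite opprB addrC -!addrA addKr.
have dA : 0 < \det A ^+ 2 by rewrite exprn_even_gt0//= -unitfE -unitmxE.
rewrite /pf_cov !det_mulmx det_tr det_inv [\det W * _]mulrC mulrK -?unitmxE//.
have -> : \det S / (\det A * \det S * \det A) = (\det A ^+ 2)^-1.
  by field; rewrite -unitfE -unitmxE Au gt_eqF.
by rewrite lnV//; ring.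
Qed.

(** * Lower bound for the objective *)

(** Sylvester's identity: [Z] and [T] multiply to a block triangular matrix in either order. It
    reduces determinants of low-rank updates of the identity to small ones. *)
Lemma det_1DmulmxC (R : comNzRingType) m n (X : 'M[R]_(m, n)) (Y : 'M[R]_(n, m)) :
  \det (1%:M + X *m Y) = \det (1%:M + Y *m X).
Proof.
pose Z : 'M[R]_(m + n) := block_mx 1%:M (- X) Y 1%:M.
pose T : 'M[R]_(m + n) := block_mx 1%:M X 0 1%:M.
have ZT : Z *m T = block_mx 1%:M 0 Y (1%:M + Y *m X).
  by rewrite mulmx_block !(mulmx1, mul1mx, mulmx0, addr0) addrN addrC.
have TZ : T *m Z = block_mx (1%:M + X *m Y) 0 Y 1%:M.
  by rewrite mulmx_block !(mulmx1, mul1mx, mul0mx, add0r) addNr.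
have: \det (T *m Z) = \det (Z *m T) by rewrite !det_mulmx mulrC.
by rewrite ZT TZ !det_lblock !det1 mul1r mulr1.
Qed.

Lemma sqn_ge0 (R : realType) n (v : 'cV[R]_n) : 0 <= sqn v.
Proof.
by rewrite /sqn mxE sumr_ge0// => i _; rewrite mxE -expr2 sqr_ge0.
Qed.

Lemma sqn_eq0 (R : realType) n (v : 'cV[R]_n) : (sqn v == 0) = (v == 0).
Proof.
apply/eqP/eqP => [|->]; last by rewrite /sqn mulmx0 mxE.
rewrite /sqn mxE => /eqP; rewrite psumr_eq0 => [/allP v0|i _]; last first.
  by rewrite mxE -expr2 sqr_ge0.
apply/matrixP => i j; rewrite ord1 mxE; apply/eqP.
have := v0 i (mem_index_enum i).
by rewrite mxE mulf_eq0 orbb.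
Qed.

Lemma sqnD (R : comNzRingType) n (a : R) (x v : 'cV[R]_n) :
  sqn (x - a *: v) = sqn x - 2 * a * (x^T *m v) 0 0 + a ^+ 2 * sqn v.
Proof.
rewrite /sqn (linearB trmx) mulmxBr !mulmxBl linearZ/= -!scalemxAl -!scalemxAr.
have -> : v^T *m x = (x^T *m v)^T by rewrite trmx_mul trmxK.
move: (x^T *m x) (x^T *m v) (v^T *m v) => X Y Z.
by rewrite !mxE; ring.
Qed.

Lemma sqnZ (R : comNzRingType) n (a : R) (v : 'cV[R]_n) :
  sqn (a *: v) = a ^+ 2 * sqn v.
Proof.
by rewrite /sqn -scalemxAr [(a *: v)^T]linearZ/= -scalemxAl scalerA mxE expr2.
Qed.

Lemma cauchy_schwarz_sqn (R : realType) n (x v : 'cV[R]_n) :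
  (x^T *m v) 0 0 ^+ 2 <= sqn x * sqn v.
Proof.
have [->|v0] := eqVneq v 0.
  by rewrite mulmx0 mxE expr0n mulr_ge0 ?sqn_ge0.
have v0' : 0 < sqn v by rewrite lt_neqAle sqn_ge0 eq_sym sqn_eq0 v0.
have := sqn_ge0 (x - ((x^T *m v) 0 0 / sqn v) *: v).
rewrite sqnD; set t := (_ *m _) 0 0.
have -> : sqn x - 2 * (t / sqn v) * t + (t / sqn v) ^+ 2 * sqn v =
  (sqn x * sqn v - t ^+ 2) / sqn v by field; rewrite gt_eqF.
by rewrite pmulr_lge0 ?invr_gt0// subr_ge0.
Qed.

(* The hypothesis on [c] says that [c] is a critical point of the right-hand side
   as a function of [r]. *)
Lemma radial_profile_min (R : realType) (a s c r : R) :
  0 < c -> 0 < r -> (1 + a ^+ 2) * c ^+ 2 - a * s * c = 1 ->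
  c ^+ 2 + (s - a * c) ^+ 2 - ln (c ^+ 2) <=
  r ^+ 2 + (s - a * r) ^+ 2 - ln (r ^+ 2).
Proof.
move=> c0 r0 crit.
(* Bounding [ln] by its tangent at [c] leaves, by criticality of [c], exactly [(1 + a^2) (r - c)^2]
   as a lower bound for the difference. *)
have lnr : ln r <= ln c + (r / c - 1).
  rewrite -lerBlDl -ln_div//.
  by rewrite -{1}[r / c](subrKC 1) le_ln1Dx// ltrBrDl subrr divr_gt0.
have ln2 (z : R) : 0 < z -> ln (z ^+ 2) = 2 * ln z by move=> z0; rewrite lnXn// mulr_natl.
rewrite !ln2//.
have rc : (1 + a ^+ 2) * c - a * s = c^-1.
  by apply: (mulIf (lt0r_neq0 c0)); rewrite mulVf ?gt_eqF//; apply: etrans crit; ring.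
have : 0 <= (1 + a ^+ 2) * (r - c) ^+ 2.
  by rewrite mulr_ge0 ?sqr_ge0// addr_ge0 ?sqr_ge0.
have crit2 : r / c - 1 = (r - c) * ((1 + a ^+ 2) * c - a * s).
  by rewrite rc mulrBl mulfV ?gt_eqF.
lra.
Qed.

Lemma objective_ge (R : realType) n (B : 'M[R]_n) (e y : 'cV[R]_n) (u s c : R) :
  B \in unitmx -> sqn e = 1 -> 0 <= s -> sqn y = s ^+ 2 -> 0 < c ->
  (1 + `|u| ^+ 2) * c ^+ 2 - `|u| * s * c = 1 ->
  n%:R - 1 + (c ^+ 2 + (s - `|u| * c) ^+ 2 - ln (c ^+ 2))
    <= objective B (u *: e) y.
Proof.
move=> Bu e1 s0 ys c0 crit.
set p := B *m e.
have p0 : 0 < sqn p.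
  rewrite lt_neqAle sqn_ge0 eq_sym sqn_eq0 andbT.
  apply: contra_eq_neq e1 => p0; rewrite -(mulKmx Bu e) -/p p0 mulmx0.
  by rewrite /sqn mulmx0 mxE eq_sym oner_eq0.
pose r := Num.sqrt (sqn p).
have r0 : 0 < r by rewrite sqrtr_gt0.
have r2 : r ^+ 2 = sqn p by rewrite sqr_sqrtr// ltW.
(* [K] rescales the direction [e] by [1 / r]; applying [posdefmx_logdet_le] to
   [K B^T B K] replaces Hadamard's inequality with an exact dependence on the
   column [B e]. *)
pose K := 1%:M + (r^-1 - 1) *: (e *m e^T).
have Ksym : K^T = K.
  by rewrite /K linearD/= linearZ/= trmx_mul trmxK trmx1.
have e1' : e^T *m e = 1%:M by rewrite [LHS]mx11_scalar -/(sqn e) e1.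
have KK : K *m K = 1%:M + (r ^- 2 - 1) *: (e *m e^T).
  rewrite /K mulmxDl mul1mx mulmxDr mulmx1 -scalemxAl -scalemxAr.
  rewrite mulmxA -(mulmxA e) e1' mulmx1 scalerA -!addrA -!scalerDl.
  by congr (_ + _ *: _); rewrite -exprVn; ring.
have dK : \det K = r^-1.
  rewrite /K scalemxAl det_1DmulmxC -scalemxAr e1'.
  by rewrite scalemx1 det_mx11 !mxE eqxx !mulr1n subrKC.
have Ku : K \in unitmx by rewrite unitmxE dK unitfE invr_eq0 gt_eqF.
have pM : posdefmx (K^T *m (B^T *m 1%:M *m B) *m K).
  apply: posdefmx_congr => //; apply: posdefmx_congr => //.
  split=> [|x x0]; first exact: trmx1.
  by rewrite /qform mulmx1 -/(sqn x) lt_neqAle sqn_ge0 eq_sym sqn_eq0 x0.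
have trM : \tr (K^T *m (B^T *m 1%:M *m B) *m K) = \tr (B^T *m B) + 1 - r ^+ 2.
  rewrite mxtrace_mulC Ksym mulmxA KK mulmx1 mulmxDl mul1mx mxtraceD.
  (* [K *m K] differs from the identity by a rank-one term, whose trace against [B^T *m B] involves
     only [|B e|^2 = r^2]. *)
  have -> : \tr ((r ^- 2 - 1) *: (e *m e^T) *m (B^T *m B)) = (r ^- 2 - 1) * r ^+ 2.
    rewrite -scalemxAl mxtraceZ -mulmxA mxtrace_mulC.
    have -> : e^T *m (B^T *m B) *m e = p^T *m p by rewrite /p trmx_mul !mulmxA.
    by rewrite [p^T *m p]mx11_scalar -/(sqn p) -r2 mxtrace_scalar.
  by field; rewrite gt_eqF.
have [_] := posdefmx_logdet_le pM.
rewrite trM !det_mulmx !det_tr det1 mulr1 dK.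
have -> : r^-1 * (\det B * \det B) * r^-1 = \det B ^+ 2 / r ^+ 2 by field; rewrite gt_eqF.
have dB : 0 < \det B ^+ 2 by rewrite exprn_even_gt0//= -unitfE -unitmxE.
rewrite ln_div ?posrE ?(exprn_gt0 _ r0)// => H.
(* After expanding both squares only the cross terms differ, and Cauchy-Schwarz compares them. *)
have H2 : (s - `|u| * r) ^+ 2 <= sqn (y - u *: p).
  rewrite sqnD ys -r2; set t := (_ *m _) 0 0.
  have tsr : `|t| <= s * r.
    rewrite -ler_sqr ?nnegrE ?mulr_ge0 ?(ltW r0)//.
    by rewrite real_normK ?num_real// exprMn r2 -ys cauchy_schwarz_sqn.
  have : u * t <= `|u| * (s * r).
    by rewrite (le_trans (ler_norm _))// normrM ler_wpM2l.
  have : `|u| ^+ 2 = u ^+ 2 by rewrite real_normK ?num_real.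
  by rewrite sqrrB exprMn => ->; lra.
have := radial_profile_min c0 r0 crit.
rewrite /objective -scalemxAr -/p; lra.
Qed.

(** * Plane updates *)

Lemma cols2_mul (R : comNzRingType) n (x y : 'cV[R]_n) (v : 'cV[R]_2) :
  cols2 x y *m v = v 0 0 *: x + v 1 0 *: y.
Proof.
apply/matrixP => i j; rewrite !ord1 !mxE !big_ord_recl big_ord0 !mxE /=.
rewrite addr0 !(mulrC (v _ _)); congr (_ + _ * v _ _); exact/val_inj.
Qed.

Lemma cols2_orthonormal (R : comNzRingType) n (x y : 'cV[R]_n) :
  x^T *m x = 1%:M -> y^T *m y = 1%:M -> x^T *m y = 0 ->
  (cols2 x y)^T *m cols2 x y = 1%:M.
Proof.
move=> xx yy xy.
have yx : y^T *m x = 0 by rewrite -[LHS]trmxK trmx_mul trmxK xy trmx0.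
have dot (a b : 'cV[R]_n) : (a^T *m b) 0 0 = \sum_k a k 0 * b k 0.
  by rewrite mxE; apply: eq_bigr => k _; rewrite mxE.
apply/matrixP => i j; rewrite !mxE.
transitivity (((if i == 0 :> nat then x else y)^T
               *m (if j == 0 :> nat then x else y)) 0 0).
  by rewrite dot; apply: eq_bigr => k _; rewrite !mxE; case: ifP; case: ifP.
case: i => [[|[|i]] //= ip]; case: j => [[|[|j]] //= jp].
all: by rewrite ?(xx, yy, xy, yx) !mxE.
Qed.

Lemma det_mx2 (R : comNzRingType) (a b c e : R) :
  \det (mx2 a b c e) = a * e - b * c.
Proof.
rewrite (expand_det_row _ 0) !big_ord_recl big_ord0 addr0 /cofactor !det_mx11 !mxE /=.
by ring.
Qed.

(* Acts as [M] on the plane spanned by the orthonormal pair [x], [y], and as the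
   identity on its orthogonal complement. *)
Definition plane_update (R : comNzRingType) n (x y : 'cV[R]_n) (M : 'M[R]_2) :
    'M[R]_n :=
  1%:M + cols2 x y *m (M - 1%:M) *m (cols2 x y)^T.

(** Sylvester's identity moves the determinant to the plane, where orthonormality leaves
    [1 + (M - 1)]. *)
Lemma det_plane_update (R : comNzRingType) n (x y : 'cV[R]_n) (M : 'M[R]_2) :
  x^T *m x = 1%:M -> y^T *m y = 1%:M -> x^T *m y = 0 ->
  \det (plane_update x y M) = \det M.
Proof.
move=> xx yy xy.
rewrite /plane_update -mulmxA det_1DmulmxC -mulmxA cols2_orthonormal// mulmx1.
by rewrite subrKC.
Qed.

Lemma plane_update_mul (R : comNzRingType) n (x y : 'cV[R]_n) (M : 'M[R]_2) :
  x^T *m x = 1%:M -> y^T *m y = 1%:M -> x^T *m y = 0 ->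
  plane_update x y M *m x = M 0 0 *: x + M 1 0 *: y.
Proof.
move=> xx yy xy.
have ex : x = cols2 x y *m delta_mx 0 0.
  by rewrite cols2_mul !mxE /= scale1r scale0r addr0.
have CC := cols2_orthonormal xx yy xy.
rewrite [X in _ *m X = _]ex /plane_update mulmxDl mul1mx -!mulmxA.
rewrite (mulmxA _^T) CC mul1mx -mulmxDr mulmxBl mul1mx subrKC.
by rewrite -colE cols2_mul !mxE.
Qed.

(** The orthogonal complement of the plane contributes [n - 2], and [M] replaces the identity's
    share on the plane. *)
Lemma mxtrace_plane_update (R : comNzRingType) n (x y : 'cV[R]_n) (M : 'M[R]_2) :
  x^T *m x = 1%:M -> y^T *m y = 1%:M -> x^T *m y = 0 ->
  \tr ((plane_update x y M)^T *m plane_update x y M) = n%:R - 2 + \tr (M^T *m M).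
Proof.
move=> xx yy xy.
set C := cols2 x y; have CC : C^T *m C = 1%:M by exact: cols2_orthonormal.
have [E ->] : exists E, M = 1%:M + E by exists (M - 1%:M); rewrite subrKC.
have -> : plane_update x y (1%:M + E) = 1%:M + C *m E *m C^T.
  by rewrite /plane_update addrAC subrr add0r.
rewrite !(linearD trmx)/= !trmx1 !trmx_mul trmxK !mulmxDl !mulmxDr !mul1mx !mulmx1.
have -> : C *m (E^T *m C^T) *m (C *m E *m C^T) = C *m (E^T *m E) *m C^T.
  by rewrite -!mulmxA (mulmxA C^T C) CC mul1mx !mulmxA.
rewrite !mxtraceD !mxtrace1 mulmxA.
have trC (F : 'M[R]_2) : \tr (C *m F *m C^T) = \tr F.
  by rewrite mxtrace_mulC mulmxA CC mul1mx.
by rewrite !trC; ring.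
Qed.

(** Positivity of [D] makes the total functions square root and inverse genuine here, so that [W]
    inverts [Vh] and the covariance factors as [Vh *m Vh^T]. *)
Lemma whitening (R : realType) n (U : 'M[R]_n) (D : 'rV[R]_n) :
  U^T *m U = 1%:M -> (forall i, 0 < D 0 i) ->
  let Vh := U *m diag_mx (\row_i Num.sqrt (D 0 i)) in
  let W := diag_mx (\row_i (Num.sqrt (D 0 i))^-1) *m U^T in
  [/\ W \in unitmx, invmx W = Vh & invmx (U *m diag_mx D *m U^T) = W^T *m W].
Proof.
move=> UU D0 Vh W.
have WV : W *m Vh = 1%:M.
  rewrite /W /Vh -mulmxA (mulmxA U^T) UU mul1mx mulmx_diag.
  rewrite -diag_const_mx; congr diag_mx; apply/rowP => i.
  by rewrite !mxE mulVf// gt_eqF// sqrtr_gt0.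
have VW := mulmx1C WV.
have [Wu _] := mulmx1_unit WV.
have EV : invmx W = Vh by rewrite -[RHS](mulKmx Wu) WV mulmx1.
split=> //.
have -> : U *m diag_mx D *m U^T = Vh *m Vh^T.
  rewrite /Vh trmx_mul tr_diag_mx -!mulmxA; congr (_ *m _).
  rewrite mulmxA mulmx_diag; congr (diag_mx _ *m _); apply/rowP => i.
  by rewrite !mxE -expr2 sqr_sqrtr// ltW.
have H : Vh *m Vh^T *m (W^T *m W) = 1%:M.
  by rewrite mulmxA -(mulmxA Vh) -trmx_mul WV trmx1 mulmx1.
have [Hu _] := mulmx1_unit H.
by rewrite -[RHS](mulKmx Hu) H mulmx1.
Qed.

Lemma mxtrace_mx2 (R : comNzRingType) (a b c e : R) :
  \tr ((mx2 a b c e)^T *m mx2 a b c e) = a ^+ 2 + b ^+ 2 + c ^+ 2 + e ^+ 2.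
Proof.
rewrite /mxtrace !big_ord_recl big_ord0 !mxE !big_ord_recl !big_ord0 !mxE /=.
by ring.
Qed.

(** The conditions on [M] are what makes its plane update attain the bound of [objective_ge]. That
    bound needs a positive radius, hence [|c|]; the condition [u * c = |u| * |c|] makes [u] and a
    possibly negative [c] agree in sign. *)
Lemma is_solution_plane_update (R : realType) n (mu w w' x y : 'cV[R]_n) (S A W : 'M[R]_n)
    (u s c : R) (M : 'M[R]_2) :
  posdefmx S -> W \in unitmx -> invmx S = W^T *m W ->
  x^T *m x = 1%:M -> y^T *m y = 1%:M -> x^T *m y = 0 ->
  W *m (w - mu) = u *: x ->
  0 < s -> sqn (W *m (w' - mu)) = s ^+ 2 ->
  c != 0 -> u * c = `|u| * `|c| ->
  (1 + u ^+ 2) * c ^+ 2 - u * s * c = 1 ->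
  \det M ^+ 2 = c ^+ 2 -> \tr (M^T *m M) = c ^+ 2 + 1 ->
  M 0 0 *: x + M 1 0 *: y = (c / s) *: (W *m (w' - mu)) ->
  W *m A *m invmx W = plane_update x y M ->
  is_solution mu S w w' A (w' - A *m w).
Proof.
move=> pS Wu SW xx yy xy wu s0 ws c0 uc crit detM trM Mx WA.
have detA : \det A = \det M.
  rewrite -(det_plane_update _ xx yy xy) -WA !det_mulmx det_inv.
  by rewrite [\det W * _]mulrC mulrK -?unitmxE.
have Au : A \in unitmx.
  rewrite unitmxE unitfE detA -sqrf_eq0.
  by rewrite detM sqrf_eq0.
have Ew : w' = A *m w + (w' - A *m w) by rewrite subrKC.
split=> // A' b' A'u Ew'.
rewrite (KL_pushforward _ pS Wu SW Au Ew) (KL_pushforward _ pS Wu SW A'u Ew').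
rewrite ler_pM2l ?invr_gt0// lerB// wu WA.
have nc : 0 < `|c| by rewrite normr_gt0.
have Bu : W *m A' *m invmx W \in unitmx by rewrite !unitmx_mul Wu A'u unitmx_inv Wu.
have x1 : sqn x = 1 by rewrite /sqn xx mxE.
have crit' : (1 + `|u| ^+ 2) * `|c| ^+ 2 - `|u| * s * `|c| = 1.
  by rewrite !real_normK ?num_real// mulrAC -uc mulrAC.
apply: le_trans (objective_ge Bu x1 (ltW s0) ws nc crit').
rewrite -uc real_normK ?num_real// /objective mxtrace_plane_update// trM.
rewrite det_plane_update// detM -scalemxAr plane_update_mul// Mx.
have -> : W *m (w' - mu) - u *: (c / s *: (W *m (w' - mu))) =
    (1 - u * c / s) *: (W *m (w' - mu)).
  by rewrite scalerA scalerBl scale1r mulrA.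
rewrite sqnZ ws -exprMn.
have -> : (1 - u * c / s) * s = s - u * c by field; rewrite gt_eqF.
lra.
Qed.

Theorem theorem1 (R : realType) (d : nat) (hd : (2 <= d)%N)
    (mu : 'cV[R]_d) (Sigma U : 'M[R]_d) (D : 'rV[R]_d)
    (hSsym : Sigma^T = Sigma)
    (hSpd : forall x : 'cV[R]_d, x != 0 -> 0 < (x^T *m Sigma *m x) 0 0)
    (hU : U^T *m U = 1%:M) (hD : forall i, 0 < D 0 i)
    (hdec : Sigma = U *m diag_mx D *m U^T)
    (w w' : 'cV[R]_d) (hw' : w' != mu)
    (muh nuh : 'cV[R]_d)
    (hmu1 : muh^T *m muh = 1%:M) (hnu1 : nuh^T *m nuh = 1%:M)
    (hmunu : muh^T *m nuh = 0)
    (u vpar vperp : R)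
    (hu : u *: muh = diag_mx (\row_i (Num.sqrt (D 0 i))^-1) *m U^T *m (w - mu))
    (hv : vpar *: muh + vperp *: nuh =
          diag_mx (\row_i (Num.sqrt (D 0 i))^-1) *m U^T *m (w' - mu)) :
  let V := vpar ^+ 2 + vperp ^+ 2 in
  exists delta1 delta2 : R,
    (delta1 = 1 \/ delta1 = -1) /\ (delta2 = 1 \/ delta2 = -1) /\
    let c := (u * Num.sqrt V + delta1 * Num.sqrt (4 + u ^+ 2 * (4 + V)))
             / (2 * (1 + u ^+ 2)) in
    let A2 := (Num.sqrt V)^-1 *:
                mx2 (c * vpar) (- (delta2 * vperp)) (c * vperp) (delta2 * vpar) in
    let Astar := 1%:M + U *m diag_mx (\row_i Num.sqrt (D 0 i))
                   *m (cols2 muh nuh *m (A2 - 1%:M) *m (cols2 muh nuh)^T)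
                   *m diag_mx (\row_i (Num.sqrt (D 0 i))^-1) *m U^T in
    exists bstar : 'cV[R]_d,
      is_solution mu Sigma w w' Astar bstar /\
      pf_cov Astar Sigma = Astar *m Sigma *m Astar^T /\
      pf_mean Astar bstar mu = Astar *m (mu - w) + w'.
Proof.
move=> V.
have pS : posdefmx Sigma by [].
have [Wu WV SW] := whitening hU hD; rewrite -hdec in SW.
set W := diag_mx _ *m U^T in Wu WV SW hu hv.
set Vh := U *m diag_mx _ in WV.
have sqy (a b : R) : sqn (a *: muh + b *: nuh) = a ^+ 2 + b ^+ 2.
  have -> : a *: muh + b *: nuh = a *: muh - (- b) *: nuh by rewrite scaleNr opprK.
  rewrite sqnD sqnZ [(a *: muh)^T]linearZ/= -scalemxAl hmunu scaler0.
  by rewrite /sqn hmu1 hnu1 !mxE eqxx mulr1n; ring.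
have Vn : sqn (W *m (w' - mu)) = V by rewrite -hv sqy.
(* Injectivity of [W] and [w' != mu] make the division by [sqrt V] genuine. *)
have V0 : 0 < V.
  rewrite -Vn lt_neqAle sqn_ge0 eq_sym sqn_eq0 andbT.
  apply: contra_neq hw' => /(congr1 (mulmx (invmx W))).
  by rewrite mulKmx// mulmx0 => /eqP; rewrite subr_eq0 => /eqP.
pose s := Num.sqrt V; have s0 : 0 < s by rewrite sqrtr_gt0.
have s2 : s ^+ 2 = V by rewrite sqr_sqrtr// ltW.
(* With this sign both terms in the numerator of [c] pull the same way, so [c = delta1 * |c|] and
   [u * c = |u| * |c|]. *)
pose delta1 : R := if 0 <= u then 1 else -1.
exists delta1, 1; split; first by rewrite /delta1; case: ifP; [left|right].
split; first by left.
move=> c A2 Astar.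
(* The constraint leaves only this translation. *)
exists (w' - Astar *m w); split; last first.
  by split=> //; rewrite /pf_mean mulmxBr addrA addrAC.
(* Under the root stands the discriminant [u^2 s^2 + 4 (1 + u^2)] of [(1 + u^2) X^2 - u s X - 1]. *)
pose q := Num.sqrt (4 + u ^+ 2 * (4 + V)).
have rad0 : 0 < 4 + u ^+ 2 * (4 + V).
  by rewrite ltr_wpDr// mulr_ge0 ?sqr_ge0// addr_ge0// ltW.
have q2 : q ^+ 2 = 4 + u ^+ 2 * (4 + s ^+ 2) by rewrite s2 sqr_sqrtr// ltW.
have q0 : 0 < q by rewrite sqrtr_gt0.
have u20 : 0 < 1 + u ^+ 2 by rewrite ltr_wpDr ?sqr_ge0.
have cE : c = (u * s + delta1 * q) / (2 * (1 + u ^+ 2)) by [].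
have d2 : delta1 ^+ 2 = 1 by rewrite /delta1; case: ifP; rewrite ?sqrrN expr1n.
have du : u = delta1 * `|u|.
  rewrite /delta1; case: ifPn => [u0|]; first by rewrite mul1r ger0_norm.
  by rewrite -ltNge => u0; rewrite mulN1r ltr0_norm// opprK.
have crit : (1 + u ^+ 2) * c ^+ 2 - u * s * c = 1.
  have c2 : 2 * (1 + u ^+ 2) * c = u * s + delta1 * q.
    by rewrite cE; field; rewrite gt_eqF.
  (* Multiplying by [4 (1 + u^2)] completes the square in [c]. *)
  have k0 : 4 * (1 + u ^+ 2) != 0 by rewrite mulf_neq0// gt_eqF.
  apply: (mulfI k0); rewrite mulr1.
  transitivity ((2 * (1 + u ^+ 2) * c) ^+ 2 - 2 * u * s * (2 * (1 + u ^+ 2) * c)).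
    by ring.
  rewrite c2; transitivity (delta1 ^+ 2 * q ^+ 2 - u ^+ 2 * s ^+ 2); first by ring.
  by rewrite d2 q2; ring.
have cdE : c = delta1 * `|c|.
  have cE' : c = delta1 * ((`|u| * s + q) / (2 * (1 + u ^+ 2))).
    by rewrite cE {1}du; ring.
  rewrite {2}cE' normrM.
  have -> : `|delta1| = 1 by rewrite /delta1; case: ifP; rewrite ?normrN normr1.
  rewrite mul1r ger0_norm//.
  have h1 : 0 <= `|u| * s by rewrite mulr_ge0// ltW.
  by rewrite divr_ge0// ?addr_ge0// ?mulr_ge0// ltW.
have c0 : c != 0.
  by apply: contra_eq_neq crit => ->; rewrite expr0n !mulr0 subrr eq_sym oner_eq0.
apply: (@is_solution_plane_update _ _ _ _ _ muh nuh _ _ W u s c A2) => //.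
- by rewrite Vn s2.
- by rewrite {1}du {1}cdE mulrACA -expr2 d2 mul1r.
(* The columns of [A2] are orthogonal of lengths [|c|] and 1, which gives its determinant [c] here
   and its squared Frobenius norm [c^2 + 1] next. *)
- rewrite /A2 detZ det_mx2 -/s !mul1r mulNr opprK.
  have -> : c * vpar * vpar + vperp * (c * vperp) = c * s ^+ 2.
    by rewrite s2 /V; ring.
  by congr (_ ^+ 2); field; rewrite gt_eqF.
- rewrite /A2 -scalemxAr [(_ *: _)^T]linearZ/= -scalemxAl !mxtraceZ mxtrace_mx2 -/s.
  have -> : (c * vpar) ^+ 2 + (- (1 * vperp)) ^+ 2 + (c * vperp) ^+ 2 +
      (1 * vpar) ^+ 2 = (c ^+ 2 + 1) * s ^+ 2 by rewrite s2 /V; ring.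
  by field; rewrite gt_eqF.
- rewrite -hv scalerDr !scalerA !mxE /= -/s.
  by congr (_ *: _ + _ *: _); ring.
(* Reassociating exposes the outer factors as [invmx W] and [W], which conjugation by [W]
   removes. *)
- have -> : Astar = 1%:M + Vh *m (cols2 muh nuh *m (A2 - 1%:M) *m (cols2 muh nuh)^T) *m W.
    by rewrite /Astar /Vh /W !mulmxA.
  rewrite WV mulmxDr mulmxDl mulmx1 -WV mulmxV// /plane_update; congr (_ + _).
  by rewrite (mulmxA W) mulmxK// mulKVmx.
Qed.
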